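(* Let $|q|<1$ and let $c$ be complex with $|c|<1$. Then \[ \sum_{n=1}^{\infty}\frac{(-1)^{n-1}nq^{n(n+1)/2}}{(1-cq^n)(q;q)_n}+\sum_{n=1}^{\infty}\frac{q^{n(n+1)}(q^{n+1};q)_\infty}{(1-q^n)(q;q)_n}F(0,q^n;cq^n) =\frac{-c}{(1-c)^2}+\frac{(q;q)_\infty}{(c;q)_\infty}\left(\frac{c}{1-c}+\sum_{n=1}^{\infty}\frac{(cq;q)_n}{(q;q)_n}\frac{q^n}{1-q^n}\right), \] where Fine's function is $F(a,b;t)=\sum_{n=0}^{\infty}\frac{(aq;q)_n}{(bq;q)_n}t^n$.
   Context: $(A;q)_0=1$, $(A;q)_n=\prod_{j=0}^{n-1}(1-Aq^j)$, $(A;q)_\infty=\lim_{n\to\infty}(A;q)_n$. *)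

(* Defs.v *)
From mathcomp Require Export all_boot all_order all_algebra.
From mathcomp Require Export complex.
From mathcomp Require Export classical_sets topology normedtype sequences reals.

Set Implicit Arguments.
Unset Strict Implicit.
Unset Printing Implicit Defensive.

Export numFieldNormedType.Exports.
Import GRing.Theory Num.Theory.
Local Open Scope classical_set_scope.
Local Open Scope ring_scope.

(* The carrier of [Cplx R] is R[i].  Going through the bundled structure lets
   the generic topology of numClosedFieldType be inferred on it, which does not
   happen on the bare type R[i]. *)
Definition Cplx (R : realType) : numClosedFieldType := R[i].

Section QSeries.
Variable K : numFieldType.
Implicit Types (A a b t q : K) (n : nat).

Definition qpoch A q n : K := \prod_(0 <= j < n) (1 - A * q ^+ j).

Definition qpoch_inf A q : K := limn (qpoch A q).

Definition fine_term a b t q n : K :=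
  qpoch (a * q) q n / qpoch (b * q) q n * t ^+ n.

(* Fine's function F(a,b;t); the base q is an explicit last argument. *)
Definition fineF a b t q : K := \big[+%R/0]_(0 <= n <oo) fine_term a b t q n.

End QSeries.

(* Main.v *)
(* Expand both series on the left in powers of [c]: with e = q^(k+1), the
   coefficients of c^k are
     A(e) = sum_n (-1)^(n-1) n q^(n(n-1)/2) e^n / (q;q)_n   and
     (e;q)_inf P(e),  P(e) = sum_n q^(n^2) e^n / ((1-q^n) (q;q)_n (e;q)_n).
   Put L(e) = sum_n e^n / ((1-q^n) (q;q)_n).  Comparing e with eq, and using the
   Euler and Cauchy expansions of (e;q)_inf and 1/(e;q)_inf, the function
   f(e) = A(e) + (e;q)_inf (P(e) - L(e)) satisfies f(e) = (1-e) f(eq) and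
   f(e) = O(e), hence vanishes.  So the left side is
   sum_k c^k (q^(k+1);q)_inf L(q^(k+1)), and summing over k first turns it into
   sum_n (q;q)_inf q^n / ((1-q^n) (q;q)_n (cq^n;q)_inf).  The difference with the
   right side is a multiple of sum_n q^n (c;q)_n / (q;q)_n, which telescopes.
   Every interchange is dominated by a product of geometric series, and all
   series may start at n = 0 because the factor 1 / (1 - q^0) is 0 in Rocq. *)
Require Import Defs.
From mathcomp Require Import boolp exp ring zify.

Set Implicit Arguments.
Unset Strict Implicit.
Unset Printing Implicit Defensive.

Import Order.TTheory GRing.Theory Num.Theory.
Local Open Scope classical_set_scope.
Local Open Scope ring_scope.

(** * Limits in numeric fields and in the complex numbers *)

Lemma cvg_numField_unique (K : numFieldType) (u : nat -> K) (s t : K) :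
  u @ \oo --> s -> u @ \oo --> t -> s = t.
Proof. exact: (cvg_unique (@norm_hausdorff K K)). Qed.

Lemma cvg_numField_lim (K : numFieldType) (u : nat -> K) (s : K) :
  u @ \oo --> s -> limn u = s.
Proof. exact: (cvg_lim (@norm_hausdorff K K)). Qed.

Lemma cvg_numField_cvgn (K : numFieldType) (u : nat -> K) (s : K) :
  u @ \oo --> s -> cvgn u.
Proof. exact: cvgP. Qed.

Lemma cvg_fun_ext (T : numFieldType) (u v : nat -> T) (l : T) :
  u @ \oo --> l -> u =1 v -> v @ \oo --> l.
Proof. by move=> H /funext <-. Qed.

Section ComplexLimits.
Variable R : realType.
Notation K := (Cplx R).
Local Notation "x %:C" := (real_complex R x : K).
Implicit Types (x r C s t l : K) (a b u : nat -> K).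

(** Comparability with 0 forces a zero imaginary part. Norms and bounds in [K] can thus be moved to
    [R], whose order is total. *)
Lemma ge0_RealC x : 0 <= x -> exists2 y : R, 0 <= y & x = y%:C.
Proof.
case: x => y z; rewrite lecE /= => /andP[/eqP z0 y0].
by exists y => //; rewrite z0.
Qed.

Lemma cvgC_dist u l :
  (forall e : R, 0 < e -> \forall n \near \oo, `|l - u n| < e%:C) ->
  u @ \oo --> l.
Proof.
move=> H; apply/cvgrPdist_lt => e e0.
have [y y0 ey] := ge0_RealC (ltW e0); rewrite ey; apply: H.
by move: e0; rewrite ey ltcR.
Qed.

Lemma cvgC_real (u : nat -> R) (l : R) :
  u @ \oo --> l -> (fun n => (u n)%:C) @ \oo --> l%:C.
Proof.
move=> /cvgrPdist_lt H; apply: cvgC_dist => e e0.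
apply: filterS (H e e0) => n; rewrite -rmorphB normc_def /= expr0n addr0.
by rewrite sqrtr_sqr ltcR.
Qed.

Lemma cvgC_squeeze u l (v : nat -> K) :
  (forall n, `|l - u n| <= v n) -> v @ \oo --> (0 : K) -> u @ \oo --> l.
Proof.
move=> H /cvgr0_norm_lt V; apply/cvgrPdist_lt => e e0.
apply: filterS (V e e0) => n; apply: le_lt_trans.
by rewrite (ger0_norm (le_trans (normr_ge0 _) (H n))).
Qed.

Lemma cvgC_geometric C r : `|r| < 1 -> (fun n => C * r ^+ n) @ \oo --> (0 : K).
Proof.
move=> r1; have [y y0 ry] := ge0_RealC (normr_ge0 r).
have [c c0 Cc] := ge0_RealC (normr_ge0 C).
have y1 : `|y| < 1 by rewrite ger0_norm // -ltcR -ry.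
apply: cvgC_squeeze (cvgC_real (cvg_geometric c y1)) => n.
by rewrite sub0r normrN normrM normrX ry Cc rmorphM rmorphXn.
Qed.

End ComplexLimits.

(** * Convergent series *)

Section HasSum.
Variable K : numFieldType.
Implicit Types (x s t : K) (a b u : nat -> K).

Definition has_sum a s := (fun N => \sum_(0 <= n < N) a n) @ \oo --> s.

Lemma has_sum_unique a s t : has_sum a s -> has_sum a t -> s = t.
Proof. exact: cvg_numField_unique. Qed.

Lemma has_sum_ext a b s : has_sum a s -> a =1 b -> has_sum b s.
Proof.
by move=> H ab; apply: (cvg_fun_ext H) => N; apply: eq_bigr => n _; rewrite ab.
Qed.

Lemma has_sumZ x a s : has_sum a s -> has_sum (fun n => x * a n) (x * s).
Proof.
move=> H. 
by apply: (cvg_fun_ext (cvgMl_tmp (a := x) H)) => N; rewrite mulr_sumr.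
Qed.

Arguments has_sumZ x {a s}.

Lemma has_sumD a b s t :
  has_sum a s -> has_sum b t -> has_sum (fun n => a n + b n) (s + t).
Proof.
by move=> H1 H2; apply: (cvg_fun_ext (cvgD H1 H2)) => N; rewrite big_split.
Qed.

Lemma has_sumB a b s t :
  has_sum a s -> has_sum b t -> has_sum (fun n => a n - b n) (s - t).
Proof.
move=> H1 H2; rewrite -[- t]mulN1r.
by apply: (has_sum_ext (has_sumD H1 (has_sumZ (-1) H2))) => n; rewrite mulN1r.
Qed.

Lemma has_sum_shift m a s :
  has_sum a s -> has_sum (fun n => a (n + m)%N) (s - \sum_(0 <= n < m) a n).
Proof.
move=> H; pose c := \sum_(0 <= n < m) a n.
have E N : \sum_(0 <= n < N + m) a n - c = \sum_(0 <= n < N) a (n + m)%N.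
  rewrite (@big_cat_nat _ _ _ m 0 (N + m)%N) ?leq_addl //= -/c [c + _]addrC addrK.
  by rewrite -{1}(add0n m) big_addn addnK.
have Hc : (fun=> c : K) @ \oo --> c by exact: cvg_cst.
have {}H : (fun N => \sum_(0 <= n < N + m) a n) @ \oo --> s.
  by have := H; rewrite -[X in X -> _](cvg_shiftn m).
apply: (cvg_fun_ext (cvgB H Hc)) => N; exact: E.
Qed.

Arguments has_sum_shift m {a s}.

Lemma has_sumS a s : has_sum a s -> has_sum (fun n => a n.+1) (s - a 0).
Proof.
move=> /(has_sum_shift 1); rewrite big_nat1 => H.
by apply: (has_sum_ext H) => n; rewrite addn1.
Qed.

Lemma has_sum_sum (a : nat -> nat -> K) (f : nat -> K) N :
  (forall k, has_sum (a k) (f k)) ->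
  has_sum (fun n => \sum_(0 <= k < N) a k n) (\sum_(0 <= k < N) f k).
Proof.
move=> H; elim: N => [|N IH].
  (* The zero series is obtained as 0 times the convergent series [a 0]. *)
  have := has_sumZ 0 (H 0%N); rewrite mul0r big_geq // => H0.
  by apply: (has_sum_ext H0) => n; rewrite mul0r big_geq.
rewrite big_nat_recr //=; apply: (has_sum_ext (has_sumD IH (H N))) => n.
by rewrite big_nat_recr.
Qed.

End HasSum.
Arguments has_sumZ {K} x {a s}.
Arguments has_sum_shift {K} m {a s}.
Arguments has_sum_sum {K a f} N.

(** * Series dominated by a geometric series, and interchange of sums *)

Section GeometricSums.
Variable R : realType.
Notation K := (Cplx R).
Local Notation "x %:C" := (real_complex R x : K).
Implicit Types (x r C s t l : K) (a b u : nat -> K).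

Lemma has_sum_le_cst a s r C : 0 <= r -> r < 1 ->
  (forall n, `|a n| <= C * r ^+ n) -> has_sum a s -> `|s| <= C / (1 - r).
Proof.
move=> r0 r1 Ha Hs.
have C0 : 0 <= C by have := le_trans (normr_ge0 _) (Ha 0%N); rewrite expr0 mulr1.
have B N : `|\sum_(0 <= n < N) a n| <= C / (1 - r).
  apply: le_trans (ler_norm_sum _ _ _) _.
  apply: le_trans (ler_sum _ (fun i _ => Ha i)) _.
  have rn1 : r != 1 by rewrite lt_eqF.
  have -> : \sum_(0 <= i < N) C * r ^+ i = C * (1 - r ^+ N) / (1 - r).
    by have := geometric_seriesE C rn1 => /(congr1 (fun f => f N)).
  rewrite ler_wpM2r ?invr_ge0 ?subr_ge0 ?(ltW r1) //.
  by rewrite ler_piMr // lerBlDr lerDl exprn_ge0.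
(* The order of [K] is partial, so the contradiction is drawn between the real values of both sides:
   a partial sum within [z - y] of [s] would have norm above [y]. *)
have [z z0 sz] := ge0_RealC (normr_ge0 s).
have [y y0 ey] : exists2 y : R, 0 <= y & C / (1 - r) = y%:C.
  by apply: ge0_RealC; rewrite divr_ge0 // subr_ge0 ltW.
rewrite sz ey lecR leNgt; apply/negP => yz.
have e0 : 0 < (z - y)%:C by rewrite ltcR subr_gt0.
have [N _ /(_ N (leqnn N)) /=] := (cvgrPdist_lt _ _).1 Hs _ e0.
have := lerB_dist s (\sum_(0 <= n < N) a n) => H1 /(le_lt_trans H1).
rewrite sz rmorphB ltrBlDr addrAC ltrBDr ltrD2l => H2.
by have := lt_le_trans H2 (B N); rewrite ey ltxx.
Qed.

Lemma has_sum_real (a : nat -> R) (c r : R) : 0 <= r -> r < 1 ->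
  (forall n, `|a n| <= c * r ^+ n) -> exists s, has_sum (fun n => (a n)%:C) s.
Proof.
move=> r0 r1 Ha.
have r1' : `|r| < 1 by rewrite ger0_norm.
have c0 : 0 <= c by have := le_trans (normr_ge0 _) (Ha 0%N); rewrite expr0 mulr1.
have := @series_le_cvg R (fun n => `|a n|) (geometric c r) (fun n => normr_ge0 _)
  (fun n => geometric_ge0 _ c0 r0) Ha (is_cvg_geometric_series r1').
move=> /(@normed_cvg R R a) /cvgC_real H.
by exists (limn (series a))%:C; apply: (cvg_fun_ext H) => N; rewrite rmorph_sum.
Qed.

(** Real and imaginary parts are dominated by the same geometric series, so each converges in
    [R]. *)
Lemma geometric_has_sum a C r : 0 <= r -> r < 1 ->
  (forall n, `|a n| <= C * r ^+ n) -> exists s, has_sum a s.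
Proof.
move=> r0 r1 Ha.
have C0 : 0 <= C by have := le_trans (normr_ge0 _) (Ha 0%N); rewrite expr0 mulr1.
have [y y0 ry] := ge0_RealC r0; have [c c0 Cc] := ge0_RealC C0.
have y1 : y < 1 by rewrite -ltcR -ry.
have E n : (c * y ^+ n)%:C = C * r ^+ n by rewrite Cc ry rmorphM rmorphXn.
have [s1 H1] : exists s, has_sum (fun n => (complex.Re (a n))%:C) s.
  apply: (has_sum_real (c := c) (r := y)) => // n.
  rewrite -lecR E; apply: le_trans (Ha n).
  exact: normc_ge_Re.
have [s2 H2] : exists s, has_sum (fun n => (complex.Im (a n))%:C) s.
  apply: (has_sum_real (c := c) (r := y)) => // n.
  rewrite -lecR E; apply: le_trans (Ha n).
  rewrite -normrN -ReiNIm; apply: le_trans (normc_ge_Re _) _.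
  by rewrite normrM (normc_def 'i%C) /= expr0n expr1n add0r sqrtr1 mulr1.
pose i0 : K := 'i%C; exists (s1 + i0 * s2).
apply: (has_sum_ext (has_sumD H1 (has_sumZ i0 H2))) => n.
by rewrite [RHS]complexE.
Qed.

Lemma has_sum_tail a s C r N : 0 <= r -> r < 1 ->
  (forall n, `|a n| <= C * r ^+ n) -> has_sum a s ->
  `|s - \sum_(0 <= n < N) a n| <= C * r ^+ N / (1 - r).
Proof.
move=> r0 r1 Ha /(has_sum_shift N); apply: has_sum_le_cst => // n.
by rewrite -mulrA -exprD addnC.
Qed.

Arguments has_sum_tail {a s C r} N.

(** After N columns the error is the sum over n of the row tails. Each tail is at most C r^n t^N /
    (1-t), so the total is O(t^N). *)
Lemma has_sum_swap (a : nat -> nat -> K) f g C r t : 0 <= r -> r < 1 ->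
    0 <= t -> t < 1 ->
    (forall n k, `|a n k| <= C * r ^+ n * t ^+ k) ->
    (forall n, has_sum (a n) (f n)) -> (forall k, has_sum (a^~ k) (g k)) ->
  exists2 s, has_sum f s & has_sum g s.
Proof.
move=> r0 r1 t0 t1 Ha Hf Hg.
have [s Hs] : exists s, has_sum f s.
  apply: (geometric_has_sum (C := C / (1 - t)) (r := r)) => // n.
  have := has_sum_le_cst t0 t1 (Ha n) (Hf n).
  by rewrite mulrAC.
exists s => //.
have t1' : `|t| < 1 by rewrite ger0_norm.
apply: cvgC_squeeze (cvgC_geometric (C / (1 - t) / (1 - r)) t1') => N.
have H1 := has_sumB Hs (has_sum_sum N Hg).
rewrite mulrAC; apply: has_sum_le_cst H1 => // n.
apply: le_trans (has_sum_tail N t0 t1 (Ha n) (Hf n)) _.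
by rewrite le_eqVlt; apply/orP; left; apply/eqP; ring.
Qed.

End GeometricSums.

(** * q-Pochhammer symbols *)

Section QPochhammer.
Variable K : numFieldType.
Implicit Types (A q : K).

Lemma qpoch0 A q : qpoch A q 0 = 1.
Proof. by rewrite /qpoch big_geq. Qed.

Lemma qpochS A q n : qpoch A q n.+1 = qpoch A q n * (1 - A * q ^+ n).
Proof. by rewrite /qpoch big_nat_recr. Qed.

Lemma qpochD A q n m : qpoch A q (n + m) = qpoch A q n * qpoch (A * q ^+ n) q m.
Proof.
elim: m => [|m IH]; first by rewrite addn0 qpoch0 mulr1.
by rewrite addnS !qpochS IH exprD !mulrA.
Qed.

Lemma qpoch1 A q : qpoch A q 1 = 1 - A.
Proof. by rewrite qpochS qpoch0 expr0 mul1r mulr1. Qed.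

Lemma qpochSl A q n : qpoch A q n.+1 = (1 - A) * qpoch (A * q) q n.
Proof. by rewrite -add1n qpochD qpoch1 expr1. Qed.

Lemma qpoch0l q n : qpoch 0 q n = 1.
Proof. by rewrite /qpoch big1_seq // => i _; rewrite mul0r subr0. Qed.

Lemma normM_expr_le A q rho n : `|q| < 1 -> `|A| <= rho -> `|A * q ^+ n| <= rho.
Proof.
move=> q1 Ar; rewrite normrM normrX; apply: le_trans Ar.
by rewrite ler_piMr // exprn_ile1 // ltW.
Qed.

Lemma one_sub_neq0 A : `|A| < 1 -> 1 - A != 0.
Proof. by move=> A1; apply: contraTneq A1 => /subr0_eq <-; rewrite normr1 ltxx. Qed.

Lemma qpoch_neq0 A q n : `|q| < 1 -> `|A| < 1 -> qpoch A q n != 0.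
Proof.
move=> q1 A1; elim: n => [|n IH]; first by rewrite qpoch0 oner_neq0.
rewrite qpochS mulf_neq0 // one_sub_neq0 //.
by apply: le_lt_trans A1; exact: normM_expr_le.
Qed.

End QPochhammer.

(** * Bounds for q-Pochhammer symbols and convergence of the infinite products *)

Section QPochhammerLimits.
Variable R : realType.
Notation K := (Cplx R).
Local Notation "x %:C" := (real_complex R x : K).
Implicit Types (A r rho q a : K).

(** This follows from 1 + x <= exp x. The induction carries the partial geometric sum in the
    exponent, which is then bounded by the full sum. *)
Lemma bounded_prod_real (a r : R) n : 0 <= a -> 0 <= r -> r < 1 ->
  \prod_(0 <= j < n) (1 + a * r ^+ j) <= expR (a / (1 - r)).
Proof.
move=> a0 r0 r1.
suff : \prod_(0 <= j < n) (1 + a * r ^+ j) <= expR (a * (1 - r ^+ n) / (1 - r)).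
  move=> /le_trans; apply; rewrite ler_expR ler_wpM2r ?invr_ge0 ?subr_ge0 ?(ltW r1) //.
  by rewrite ler_piMr // lerBlDr lerDl exprn_ge0.
have r1' : 1 - r != 0 by rewrite subr_eq0 eq_sym lt_eqF.
elim: n => [|n IH]; first by rewrite big_geq // expr0 subrr mulr0 mul0r expR0.
have -> : a * (1 - r ^+ n.+1) / (1 - r) = a * (1 - r ^+ n) / (1 - r) + a * r ^+ n.
  by rewrite exprS; field.
rewrite expRD big_nat_recr //=; apply: ler_pM => //; last exact: expR_ge1Dx.
  by apply: prodr_ge0 => i _; rewrite addr_ge0 // mulr_ge0 // exprn_ge0.
by rewrite addr_ge0 // mulr_ge0 // exprn_ge0.
Qed.

Lemma bounded_prod a r : 0 <= a -> 0 <= r -> r < 1 ->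
  exists M : K, forall n, \prod_(0 <= j < n) (1 + a * r ^+ j) <= M.
Proof.
move=> a0 r0 r1; have [x x0 ax] := ge0_RealC a0; have [y y0 ry] := ge0_RealC r0.
have y1 : y < 1 by rewrite -ltcR -ry.
exists (expR (x / (1 - y)))%:C => n.
have : (\prod_(0 <= j < n) (1 + x * y ^+ j))%:C <= (expR (x / (1 - y)))%:C.
  by rewrite lecR bounded_prod_real.
apply: le_trans; rewrite le_eqVlt; apply/orP; left; apply/eqP.
rewrite rmorph_prod; apply: eq_bigr => j _.
by rewrite ax ry rmorphD rmorph1 rmorphM rmorphXn.
Qed.

Lemma norm_qpoch_bounded A q : `|q| < 1 ->
  exists M : K, forall n, `|qpoch A q n| <= M.
Proof.
move=> q1; have [M HM] := bounded_prod (normr_ge0 A) (normr_ge0 q) q1.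
exists M => n; apply: le_trans (HM n).
rewrite /qpoch normr_prod; apply: ler_prod => j _; rewrite normr_ge0 /=.
by apply: le_trans (ler_normB _ _) _; rewrite normr1 normrM normrX.
Qed.

(** Each factor satisfies 1/|1 - A q^j| <= 1/(1 - rho |q|^j) <= 1 + rho/(1-rho) |q|^j, so
    [bounded_prod] applies. The bound is uniform in A, as the series with e-dependent coefficients
    require. *)
Lemma inv_qpoch_bounded rho q : `|q| < 1 -> 0 <= rho -> rho < 1 ->
  exists2 M : K, 1 <= M & forall A n, `|A| <= rho -> `|(qpoch A q n)^-1| <= M.
Proof.
move=> q1 rho0 rho1.
have rho1' : 0 < 1 - rho by rewrite subr_gt0.
have a0 : 0 <= rho / (1 - rho) by rewrite divr_ge0 // ltW.
have [M HM] := bounded_prod a0 (normr_ge0 q) q1.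
exists M; first by have := HM 0%N; rewrite big_geq.
move=> A n Ar; apply: le_trans (HM n).
rewrite normfV /qpoch normr_prod -prodfV; apply: ler_prod => j _.
rewrite invr_ge0 normr_ge0 /=.
have qj0 : 0 <= `|q| ^+ j by rewrite exprn_ge0.
have qj1 : `|q| ^+ j <= 1 by rewrite exprn_ile1 // ltW.
have H : 1 - rho * `|q| ^+ j <= `|1 - A * q ^+ j|.
  apply: le_trans (lerB_dist _ _); rewrite normr1 lerB // normrM normrX.
  by rewrite ler_wpM2r.
have p0 : 0 < 1 - rho * `|q| ^+ j.
  by rewrite subr_gt0; apply: le_lt_trans rho1; rewrite ler_piMr.
have p1 : 0 < `|1 - A * q ^+ j| by apply: lt_le_trans H.
rewrite -[_^-1]mul1r ler_pdivrMr //.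
apply: (@le_trans _ _ ((1 + rho / (1 - rho) * `|q| ^+ j) * (1 - rho * `|q| ^+ j))).
  rewrite -subr_ge0.
  have -> : (1 + rho / (1 - rho) * `|q| ^+ j) * (1 - rho * `|q| ^+ j) - 1
    = rho ^+ 2 / (1 - rho) * `|q| ^+ j * (1 - `|q| ^+ j).
    by field; rewrite gt_eqF.
  by rewrite !mulr_ge0 ?exprn_ge0 ?invr_ge0 ?subr_ge0 ?(ltW rho1).
by rewrite ler_wpM2l // addr_ge0 // mulr_ge0.
Qed.

(** The increments -A (A;q)_n q^n are dominated by a geometric series, and their partial sums
    telescope. *)
Lemma cvg_qpoch A q : `|q| < 1 -> qpoch A q @ \oo --> qpoch_inf A q.
Proof.
move=> q1; suff : exists l : K, qpoch A q @ \oo --> l.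
  by move=> [l Hl]; rewrite /qpoch_inf (cvg_numField_lim Hl).
have [M HM] := norm_qpoch_bounded A q1.
have [s Hs] : exists s, has_sum (fun n => qpoch A q n.+1 - qpoch A q n) s.
  apply: (geometric_has_sum (C := `|A| * M) (normr_ge0 q) q1) => n.
  have -> : qpoch A q n.+1 - qpoch A q n = - (A * qpoch A q n * q ^+ n).
    by rewrite qpochS; ring.
  by rewrite normrN 2!normrM normrX !ler_wpM2r ?exprn_ge0 // ler_wpM2l.
exists (s + 1).
have Hc : (fun=> 1 : K) @ \oo --> (1 : K) by exact: cvg_cst.
apply: (cvg_fun_ext (cvgD Hs Hc)) => N.
have E : \sum_(0 <= n < N) (qpoch A q n.+1 - qpoch A q n) + 1 = qpoch A q N.
  by rewrite telescope_sumr // qpoch0 subrK.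
exact: E.
Qed.

Lemma qpoch_infE A q n : `|q| < 1 ->
  qpoch_inf A q = qpoch A q n * qpoch_inf (A * q ^+ n) q.
Proof.
move=> q1; apply: (cvg_numField_unique (u := fun m => qpoch A q (m + n))).
  by have := cvg_qpoch (A := A) q1; rewrite -(cvg_shiftn n).
apply: (cvg_fun_ext (cvgMl_tmp (a := qpoch A q n) (cvg_qpoch (A := A * q ^+ n) q1))) => m.
by rewrite addnC qpochD.
Qed.

(** The partial products stay at least 1/M in modulus, M being a bound for their inverses. *)
Lemma qpoch_inf_neq0 A q : `|q| < 1 -> `|A| < 1 -> qpoch_inf A q != 0.
Proof.
move=> q1 A1; have [M M1 HM] := inv_qpoch_bounded q1 (normr_ge0 A) A1.
have M0 : 0 < M by apply: lt_le_trans M1.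
apply/eqP => E; have := cvg_qpoch (A := A) q1; rewrite E => /cvgr0_norm_lt H.
have Mi : 0 < M^-1 by rewrite invr_gt0.
have [N _ /(_ N (leqnn N)) /= ] := H _ Mi.
have x0 : 0 < `|qpoch A q N| by rewrite normr_gt0 qpoch_neq0.
move=> /lt_geF /negP; apply.
by rewrite -[X in _ <= X]invrK lef_pV2 ?posrE ?invr_gt0 // -normfV HM.
Qed.

End QPochhammerLimits.

(** * Power series on [|e| <= |q|] and their q-difference equations *)

Section PowerSeries.
Variables (R : realType) (q : Cplx R).
Hypothesis q1 : `|q| < 1.
Notation K := (Cplx R).
Implicit Types (e x L C B : K) (b : nat -> K) (f : K -> K).

Definition power_sum b e : K := limn (fun N => \sum_(0 <= n < N) b n * e ^+ n).

Lemma normM_expr_le_base b B e n : (forall n, `|b n| <= B) -> `|e| <= `|q| ->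
  `|b n * e ^+ n| <= B * `|q| ^+ n.
Proof.
by move=> bB eq; rewrite normrM normrX ler_pM ?exprn_ge0 // lerXn2r ?nnegrE.
Qed.

Lemma has_power_sum b B e : (forall n, `|b n| <= B) -> `|e| <= `|q| ->
  has_sum (fun n => b n * e ^+ n) (power_sum b e).
Proof.
move=> bB eq; have [s Hs] : exists s, has_sum (fun n => b n * e ^+ n) s.
  apply: (geometric_has_sum (C := B) (normr_ge0 q) q1) => n.
  exact: normM_expr_le_base.
by rewrite /power_sum (cvg_numField_lim Hs).
Qed.

(** One factor e is taken out of every term with n >= 1; the rest is dominated by B |q|^n. *)
Lemma power_sum_near0 b B e : (forall n, `|b n| <= B) -> `|e| <= `|q| ->
  `|power_sum b e - b 0%N| <= B / (1 - `|q|) * `|e|.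
Proof.
move=> bB eq; have := has_sumS (has_power_sum bB eq); rewrite expr0 mulr1.
rewrite mulrAC; apply: has_sum_le_cst => // n.
rewrite exprS mulrCA normrM mulrC -mulrA [`|e| * _]mulrC mulrA ler_wpM2r //.
exact: (normM_expr_le_base (b := fun n => b n.+1)).
Qed.

Lemma near0_cvg f L C e : (forall e, `|e| <= `|q| -> `|f e - L| <= C * `|e|) ->
  `|e| <= `|q| -> (fun n => f (e * q ^+ n)) @ \oo --> L.
Proof.
move=> fL eq; have nq1 : `| `|q| | < 1 by rewrite normr_id.
apply: cvgC_squeeze (cvgC_geometric (C * `|e|) nq1) => n.
by rewrite distrC -mulrA -normrX -normrM fL ?normM_expr_le.
Qed.

(** Iteration gives f(e) = (e;q)_n f(e q^n), and f(e q^n) tends to L. With L = 0 this is the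
    vanishing criterion. *)
Lemma shift_eq_qpoch_inf f L C :
    (forall e, `|e| <= `|q| -> f e = (1 - e) * f (e * q)) ->
    (forall e, `|e| <= `|q| -> `|f e - L| <= C * `|e|) ->
  forall e, `|e| <= `|q| -> f e = qpoch_inf e q * L.
Proof.
move=> fM fL e eq.
apply: (cvg_numField_unique (u := fun n => qpoch e q n * f (e * q ^+ n))); last first.
  exact: cvgM (cvg_qpoch q1) (near0_cvg fL eq).
have Hc : (fun=> f e) @ \oo --> (f e : K) by exact: cvg_cst.
apply: (cvg_fun_ext Hc) => n.
elim: n => [|n ->]; first by rewrite qpoch0 mul1r expr0 mulr1.
by rewrite fM ?normM_expr_le // qpochS exprSr !mulrA.
Qed.

Lemma shift_eq_inv_qpoch_inf f L C :
    (forall e, `|e| <= `|q| -> (1 - e) * f e = f (e * q)) ->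
    (forall e, `|e| <= `|q| -> `|f e - L| <= C * `|e|) ->
  forall e, `|e| <= `|q| -> qpoch_inf e q * f e = L.
Proof.
move=> fM fL e eq.
apply: (cvg_numField_unique (u := fun n => qpoch e q n * f e)).
  by apply: cvgMr_tmp; exact: cvg_qpoch.
apply: (cvg_fun_ext (near0_cvg fL eq)) => n.
elim: n => [|n IH]; first by rewrite qpoch0 mul1r expr0 mulr1.
by rewrite exprSr mulrA -fM ?normM_expr_le // IH qpochS; ring.
Qed.

(** * The six coefficient sequences and a common bound *)

Lemma one_sub_expr_neq0 n : 1 - q ^+ n.+1 != 0.
Proof.
apply: one_sub_neq0; rewrite exprS; apply: le_lt_trans q1.
exact: normM_expr_le.
Qed.

(** [euler_coef] belongs to Euler's expansion of (e;q)_inf, [geom_coef] and [cauchy_coef] to Euler's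
    and Cauchy's expansions of 1/(e;q)_inf. [weighted_coef], [square_coef] and [lambert_coef] give
    the functions A, P and L. *)
Definition euler_coef n : K := (-1) ^+ n * q ^+ 'C(n, 2) / qpoch q q n.
Definition weighted_coef n : K :=
  (-1) ^+ n.-1 * n%:R * q ^+ 'C(n, 2) / qpoch q q n.
Definition geom_coef n : K := (qpoch q q n)^-1.
Definition cauchy_coef e n : K :=
  q ^+ (n * n) / (qpoch q q n * qpoch e q n.+1).
(* At n = 0 the junk value 1 / (1 - q^0) = 0 makes [square_coef] and
   [lambert_coef] vanish. *)
Definition square_coef e n : K :=
  q ^+ (n * n) / ((1 - q ^+ n) * qpoch q q n * qpoch e q n).
Definition lambert_coef n : K := ((1 - q ^+ n) * qpoch q q n)^-1.

(** The n powers |q|^i with i < n are all at least |q|^(n-1), and their sum is at most 1/(1-|q|).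
    This absorbs the factor n of [weighted_coef], since C(n,2) >= n-1. *)
Lemma natr_exprn_bounded n : n%:R * `|q| ^+ n.-1 <= (1 - `|q|)^-1.
Proof.
have q0 := normr_ge0 q; have q1' : 0 < 1 - `|q| by rewrite subr_gt0.
case: n => [|n]; first by rewrite mul0r invr_ge0 ltW.
rewrite -[leRHS]mul1r ler_pdivlMr //=.
have : n.+1%:R * `|q| ^+ n <= \sum_(0 <= i < n.+1) `|q| ^+ i.
  rewrite mulr_natl -[X in _ *+ X](subn0 n.+1) -sumr_const_nat.
  rewrite !big_nat; apply: ler_sum => i /andP[_ ilen].
  by rewrite ler_wiXn2l // ltW.
move=> /(ler_wpM2r (ltW q1')) /le_trans; apply.
have -> : (\sum_(0 <= i < n.+1) `|q| ^+ i) * (1 - `|q|) = 1 - `|q| ^+ n.+1.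
  rewrite mulrBr mulr1 mulr_suml.
  elim: n => [|n IH]; first by rewrite !big_nat1; ring.
  rewrite big_nat_recr //= [X in _ - X]big_nat_recr //= opprD addrACA IH.
  by rewrite -exprSr; ring.
by rewrite lerBlDr lerDl exprn_ge0.
Qed.

Lemma coef_bounds : exists B : K,
  [/\ forall n, `|euler_coef n| <= B, forall n, `|weighted_coef n| <= B,
      forall n, `|geom_coef n| <= B, forall n, `|lambert_coef n| <= B
    & forall e n, `|e| <= `|q| ->
        `|cauchy_coef e n| <= B /\ `|square_coef e n| <= B].
Proof.
have q0 := normr_ge0 q.
(* M bounds every inverse factor, including 1/(1-q^n) as a one-factor symbol. At most three of them
   occur together, and 1/(1-|q|) accounts for the weight n. *)
have [M M1 HM] := inv_qpoch_bounded q1 q0 q1.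
have M0 : 0 <= M by apply: le_trans M1.
have I1 : 1 <= (1 - `|q|)^-1 by rewrite invf_ge1 ?subr_gt0 // lerBlDr lerDl.
have H1 n : `|(1 - q ^+ n)^-1| <= M.
  case: n => [|n]; first by rewrite subrr invr0 normr0.
  by rewrite -(qpoch1 _ q) HM // exprS normM_expr_le.
have Hq n : `|q ^+ n| <= 1 by rewrite normrX exprn_ile1 // ltW.
have MM : M <= M * M * M by rewrite -mulrA ler_peMr // mulr_ege1.
have MM2 : M * M <= M * M * M by rewrite ler_peMr // mulr_ge0.
have B0 : 0 <= M * M * M by rewrite !mulr_ge0.
have MMB : M * M * M <= M * M * M * (1 - `|q|)^-1 by rewrite ler_peMr.
have Hle x : x <= M * M * M -> x <= M * M * M * (1 - `|q|)^-1.
  by move=> /le_trans; apply.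
exists (M * M * M * (1 - `|q|)^-1); split=> [n|n|n|n|e n eq].
- apply: Hle; apply: le_trans MM.
  rewrite /euler_coef 2!normrM normrX normrN1 expr1n mul1r.
  by rewrite -[leRHS]mul1r ler_pM // HM.
- rewrite /weighted_coef [X in `|X|](_ : _ = (qpoch q q n)^-1 *
    ((-1) ^+ n.-1 * (n%:R * q ^+ 'C(n, 2)))); last by ring.
  rewrite 2!normrM normrX normrN1 expr1n mul1r ler_pM //.
    exact: le_trans (HM _ _ _) MM.
  apply: le_trans (natr_exprn_bounded n).
  rewrite normrM normr_nat ler_wpM2l // normrX ler_wiXn2l // ?ltW //.
  case: (n) => [//|m]; rewrite binS bin1.
  by case: m => // m; rewrite leq_addl.
- by apply: Hle; apply: le_trans MM; exact: HM.
- apply: Hle; apply: le_trans MM2.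
  by rewrite /lambert_coef invfM normrM ler_pM // HM.
- have H x y z : `|x| <= 1 -> `|y^-1| <= M * M -> `|z^-1| <= M ->
    `|x / (y * z)| <= M * M * M * (1 - `|q|)^-1.
    move=> hx hy hz; apply: Hle; rewrite invfM 2!normrM -[leRHS]mul1r.
    by rewrite ler_pM ?mulr_ge0 // ler_pM.
  have Hm : `|(qpoch q q n)^-1| <= M * M.
    by apply: le_trans (HM _ _ _) _; rewrite // ler_peMr.
  by split; apply: H => //; rewrite ?HM // invfM normrM ler_pM // HM.
Qed.

Definition euler_sum := power_sum euler_coef.
Definition weighted_sum := power_sum weighted_coef.
Definition geom_sum := power_sum geom_coef.
Definition lambert_sum := power_sum lambert_coef.
(** Here the coefficients vary with e; [power_sum] still serves because their bound is uniform in
    e. *)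
Definition cauchy_sum e := power_sum (cauchy_coef e) e.
Definition square_sum e := power_sum (square_coef e) e.

(** * Shift equations relating the values at e and eq *)

Lemma qpochS_neq0 A n : `|A| <= `|q| -> 1 - A * q ^+ n != 0.
Proof.
by move=> Aq; apply/one_sub_neq0/(le_lt_trans _ q1)/normM_expr_le.
Qed.

Lemma qpoch_small_neq0 A n : `|A| <= `|q| -> qpoch A q n != 0.
Proof. by move=> Aq; apply: qpoch_neq0 => //; apply: le_lt_trans q1. Qed.

Lemma one_sub_small_neq0 A : `|A| <= `|q| -> 1 - A != 0.
Proof. by move=> Aq; apply/one_sub_neq0/(le_lt_trans Aq). Qed.

Lemma normM_base_le e : `|e| <= `|q| -> `|e * q| <= `|q|.
Proof. exact: (normM_expr_le 1). Qed.

Lemma power_sumB b b' B e e' s :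
    (forall n, `|b n| <= B) -> (forall n, `|b' n| <= B) ->
    `|e| <= `|q| -> `|e'| <= `|q| -> b 0%N = b' 0%N ->
    has_sum (fun n => b n.+1 * e ^+ n.+1 - b' n.+1 * e' ^+ n.+1) s ->
  power_sum b e - power_sum b' e' = s.
Proof.
move=> bB bB' eq eq' b0 Hs.
have := has_sumS (has_sumB (has_power_sum bB eq) (has_power_sum bB' eq')).
move: (power_sum b e) (power_sum b' e') => x y.
by rewrite !expr0 b0 subrr subr0 => H; exact: has_sum_unique H Hs.
Qed.

(** The factor 1 - q^(n+1) from e^(n+1) - (eq)^(n+1) cancels the last factor of (q;q)_(n+1), leaving
    -e times the nth term at eq. *)
Lemma euler_sum_shift e : `|e| <= `|q| ->
  euler_sum e = (1 - e) * euler_sum (e * q).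
Proof.
move=> eq; have [B [bE _ _ _ _]] := coef_bounds; have eqq := normM_base_le eq.
suff : euler_sum e - euler_sum (e * q) = - e * euler_sum (e * q).
  by move: (euler_sum e) (euler_sum _) => x y /eqP; rewrite subr_eq => /eqP ->; ring.
apply: (power_sumB bE bE eq eqq (erefl _)); have H' := has_power_sum bE eqq.
apply: (has_sum_ext (has_sumZ (- e) H')) => n.
have n0 := qpoch_small_neq0 n (lexx `|q|).
have n1 := qpochS_neq0 n (lexx `|q|).
rewrite /euler_coef qpochS binS bin1 exprD !exprMn [(-1) ^+ n.+1]exprS.
rewrite [e ^+ n.+1]exprS [q ^+ n.+1]exprS.
by field; rewrite n0 n1.
Qed.

Lemma geom_sum_shift e : `|e| <= `|q| ->
  (1 - e) * geom_sum e = geom_sum (e * q).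
Proof.
move=> eq; have [B [_ _ bG _ _]] := coef_bounds; have eqq := normM_base_le eq.
suff : geom_sum e - geom_sum (e * q) = e * geom_sum e.
  by move: (geom_sum e) (geom_sum _) => x y xy; rewrite mulrBl mul1r -xy; ring.
apply: (power_sumB bG bG eq eqq (erefl _)); have H := has_power_sum bG eq.
apply: (has_sum_ext (has_sumZ e H)) => n.
have n0 := qpoch_small_neq0 n (lexx `|q|).
have n1 := qpochS_neq0 n (lexx `|q|).
rewrite /geom_coef qpochS exprMn [e ^+ n.+1]exprS [q ^+ n.+1]exprS.
by field; rewrite n0 n1.
Qed.

(** Formally this is -e d/de applied to [euler_sum_shift], since [weighted_coef m] is -m times
    [euler_coef m]. *)
Lemma weighted_sum_shift e : `|e| <= `|q| ->
  weighted_sum e = (1 - e) * weighted_sum (e * q) + e * euler_sum (e * q).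
Proof.
move=> eq; have [B [bE bA _ _ _]] := coef_bounds; have eqq := normM_base_le eq.
have H' := has_power_sum bA eqq; have HE := has_power_sum bE eqq.
suff : weighted_sum e - weighted_sum (e * q)
    = e * (euler_sum (e * q) - weighted_sum (e * q)).
  move: (weighted_sum e) (weighted_sum _) (euler_sum _) => x y z /eqP.
  by rewrite subr_eq => /eqP ->; ring.
apply: (power_sumB bA bA eq eqq (erefl _)).
apply: (has_sum_ext (has_sumZ e (has_sumB HE H'))) => n.
have n0 := qpoch_small_neq0 n (lexx `|q|).
have n1 := qpochS_neq0 n (lexx `|q|).
have W m : weighted_coef m = - (m%:R * euler_coef m).
  case: m => [|m]; first by rewrite /weighted_coef mulr0 !mul0r oppr0.
  by rewrite /weighted_coef /euler_coef [(-1) ^+ m.+1]exprS -pred_Sn; ring.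
rewrite !W /euler_coef qpochS binS bin1 exprD !exprMn [(-1) ^+ n.+1]exprS.
rewrite [e ^+ n.+1]exprS [q ^+ n.+1]exprS -[n.+1%:R]natr1.
by field; rewrite n0 n1.
Qed.

Lemma lambert_sum_shift e : `|e| <= `|q| ->
  lambert_sum e - lambert_sum (e * q) = geom_sum e - 1.
Proof.
move=> eq; have [B [_ _ bG bR _]] := coef_bounds; have eqq := normM_base_le eq.
have HG := has_sumS (has_power_sum bG eq).
have g0 : geom_coef 0 * e ^+ 0 = 1 by rewrite /geom_coef qpoch0 invr1 expr0 mulr1.
rewrite g0 in HG; apply: (power_sumB bR bR eq eqq (erefl _)).
apply: (has_sum_ext HG) => n.
have n0 := qpoch_small_neq0 n (lexx `|q|).
have n1 := qpochS_neq0 n (lexx `|q|).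
rewrite /lambert_coef /geom_coef qpochS exprMn [q ^+ n.+1]exprS.
by field; rewrite n0 n1.
Qed.

(** Over the common denominator (e;q)_(n+1) the difference of terms has numerator (1 - e q^n) - q^n
    (1 - e) = 1 - q^n, which cancels the extra factor 1/(1-q^n). *)
Lemma square_sum_shift e : `|e| <= `|q| ->
  square_sum e - square_sum (e * q) = cauchy_sum e - (1 - e)^-1.
Proof.
move=> eq; have [B [_ _ _ _ bC]] := coef_bounds; have eqq := normM_base_le eq.
have HC := has_sumS (has_power_sum (fun n => (bC _ n eq).1) eq).
have c0 : cauchy_coef e 0 * e ^+ 0 = (1 - e)^-1.
  by rewrite /cauchy_coef qpoch0 qpoch1 muln0 !expr0 !mul1r mulr1.
rewrite c0 in HC.
have s0 : square_coef e 0 = square_coef (e * q) 0.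
  by rewrite /square_coef expr0 subrr !mul0r.
apply: (power_sumB (fun n => (bC _ n eq).2) (fun n => (bC _ n eqq).2) eq eqq s0).
apply: (has_sum_ext HC) => n.
have n0 := qpoch_small_neq0 n (lexx `|q|).
have n1 := qpochS_neq0 n (lexx `|q|).
have n2 := qpoch_small_neq0 n eqq.
have n3 := qpochS_neq0 n eqq.
have n4 := one_sub_small_neq0 eq.
rewrite /square_coef /cauchy_coef (qpochS q) [qpoch e q n.+2]qpochSl.
rewrite [qpoch e q n.+1]qpochSl (qpochS (e * q)) exprMn [q ^+ n.+1]exprS.
by field; rewrite n0 n1 n2 n3 n4.
Qed.

Lemma cauchy_sum_shift e : `|e| <= `|q| ->
  (1 - e) * cauchy_sum e = cauchy_sum (e * q).
Proof.
move=> eq; have [B [_ _ _ _ bC]] := coef_bounds; have eqq := normM_base_le eq.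
have H := has_sumZ (1 - e) (has_power_sum (fun n => (bC _ n eq).1) eq).
have H' := has_power_sum (fun n => (bC _ n eqq).1) eqq.
(* Writing T_n for the terms of the left side and S_n for those of the right
   side, b_n e^n = (1 - q^n) T_n satisfies b_(n+1) e^(n+1) - b_n e^n = S_n - T_n. *)
pose b n := (1 - q ^+ n) * ((1 - e) * cauchy_coef e n).
have Hb n : `|b n| <= 2 * (2 * B).
  have le2 (x : K) : `|x| <= 1 -> `|1 - x| <= 2.
    by move=> x1; apply: le_trans (ler_normB _ _) _; rewrite normr1 lerD2l.
  rewrite normrM ler_pM //; first by rewrite le2 // normrX exprn_ile1 // ltW.
  rewrite normrM ler_pM //; last exact: (bC _ n eq).1.
  by rewrite le2 // (le_trans eq) // ltW.
have [s Hs] : exists s, has_sum (fun n => b n * e ^+ n) s.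
  by exists (power_sum b e); apply: has_power_sum Hb eq.
have b0 : b 0%N * e ^+ 0 = 0 by rewrite /b expr0 subrr !mul0r.
have Hs' := has_sumS Hs; rewrite b0 subr0 in Hs'.
apply/esym/subr0_eq; apply: (has_sum_unique (has_sumB H' H)).
(* As b_0 = 0, the series b_n e^n and its shift have the same sum, so the differences sum to 0. *)
rewrite -(subrr s); apply: (has_sum_ext (has_sumB Hs' Hs)) => n.
have n0 := qpoch_small_neq0 n (lexx `|q|).
have n1 := qpochS_neq0 n (lexx `|q|).
have n2 := qpoch_small_neq0 n eqq.
have n3 := qpochS_neq0 n eqq.
have n4 := one_sub_small_neq0 eq.
rewrite /b /cauchy_coef (qpochS q) [qpoch e q n.+2]qpochSl.
rewrite [qpoch e q n.+1]qpochSl !(qpochS (e * q)) exprMn [e ^+ n.+1]exprS.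
have -> : (n.+1 * n.+1 = n * n + n + n + 1)%N by lia.
rewrite !exprD expr1 [q ^+ n.+1]exprS.
by field; rewrite n0 n1 n2 n3 n4.
Qed.

(** * Product formulas and the identity between the series *)

Lemma norm_le_of_near0 (x L y : K) D : `|x - L| <= D * `|y| -> `|y| <= 1 ->
  0 <= D -> `|x| <= `|L| + D.
Proof.
move=> H y1 D0; rewrite -[x](subrK L) addrC; apply: le_trans (ler_normD _ _) _.
by rewrite lerD2l (le_trans H) // ler_piMr.
Qed.

Lemma euler_sumE e : `|e| <= `|q| -> euler_sum e = qpoch_inf e q.
Proof.
move=> eq; have [B [bE _ _ _ _]] := coef_bounds; rewrite -[RHS]mulr1.
apply: (shift_eq_qpoch_inf euler_sum_shift _ eq) => x xq.
have := power_sum_near0 bE xq.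
by rewrite {2}/euler_coef qpoch0 bin0n expr0 expr0 mulr1 divr1; exact.
Qed.

Lemma geom_sumE e : `|e| <= `|q| -> qpoch_inf e q * geom_sum e = 1.
Proof.
move=> eq; have [B [_ _ bG _ _]] := coef_bounds.
apply: (shift_eq_inv_qpoch_inf geom_sum_shift _ eq) => x xq.
have := power_sum_near0 bG xq.
by rewrite {2}/geom_coef qpoch0 invr1; exact.
Qed.

Lemma cauchy_sumE e : `|e| <= `|q| -> qpoch_inf e q * cauchy_sum e = 1.
Proof.
move=> eq; have [B [_ _ _ _ bC]] := coef_bounds.
(* The term at n = 0 is 1/(1-x) rather than 1. The difference x/(1-x) costs the extra B, which
   bounds 1/(1-x) as a coefficient. *)
apply: (shift_eq_inv_qpoch_inf (C := B / (1 - `|q|) + B) cauchy_sum_shift _ eq).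
move=> x xq; have H := power_sum_near0 (fun n => (bC _ n xq).1) xq.
have c0 : cauchy_coef x 0 = (1 - x)^-1.
  by rewrite /cauchy_coef qpoch0 qpoch1 muln0 expr0 !mul1r.
have := (bC _ 0%N xq).1; rewrite c0 in H *; move: H; rewrite /cauchy_sum.
move: (power_sum _ x) => y H Bx.
have -> : y - 1 = (y - (1 - x)^-1) + (1 - x)^-1 * x.
  by field; rewrite one_sub_small_neq0.
apply: le_trans (ler_normD _ _) _; rewrite mulrDl lerD // normrM.
by rewrite ler_wpM2r.
Qed.

Lemma weighted_square_lambert e : `|e| <= `|q| ->
  weighted_sum e + qpoch_inf e q * (square_sum e - lambert_sum e) = 0.
Proof.
move=> eq; have [B [bE bA bG bR bC]] := coef_bounds.
have q1' := ltW q1; have qs0 : 0 < 1 - `|q| by rewrite subr_gt0.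
pose f x := weighted_sum x + euler_sum x * (square_sum x - lambert_sum x).
(* With E = (x;q)_inf, the products of E with the two expansions of 1/E cancel. What remains, E (1 -
   1/(1-x)) = -x (xq;q)_inf, cancels the inhomogeneous term of [weighted_sum_shift]. *)
have fM x : `|x| <= `|q| -> f x = (1 - x) * f (x * q).
  move=> xq; have EG := geom_sumE xq; have EH := cauchy_sumE xq.
  rewrite -euler_sumE // in EG EH.
  have S1 := weighted_sum_shift xq; have S2 := euler_sum_shift xq.
  have S3 := square_sum_shift xq; have S4 := lambert_sum_shift xq.
  have x1 := one_sub_small_neq0 xq; rewrite /f.
  move: (weighted_sum x) (weighted_sum (x * q)) (euler_sum x) (euler_sum (x * q))
    (square_sum x) (square_sum (x * q)) (lambert_sum x) (lambert_sum (x * q))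
    (cauchy_sum x) (geom_sum x) S1 S2 S3 S4 EG EH
    => a a' ee ee' s s' l l' h g -> S2 S3 S4 EG EH.
  have -> : s - l = (s' - l') + (h - (1 - x)^-1 - (g - 1)) by rewrite -S3 -S4; ring.
  have -> : ee * (s' - l' + (h - (1 - x)^-1 - (g - 1)))
     = ee * (s' - l') + (ee * h - ee / (1 - x) - ee * g + ee) by ring.
  by rewrite EG EH S2; field.
have f0 x : `|x| <= `|q| -> `|f x - 0| <=
    (B / (1 - `|q|) + (1 + B / (1 - `|q|)) * (B / (1 - `|q|) + B / (1 - `|q|))) * `|x|.
  move=> xq; have x1 := le_trans xq q1'.
  have B0 : 0 <= B by apply: le_trans (bE 0%N).
  have D0 : 0 <= B / (1 - `|q|) by rewrite divr_ge0 // ltW.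
  have H1 := power_sum_near0 bA xq; have H2 := power_sum_near0 bE xq.
  have H3 := power_sum_near0 (fun n => (bC _ n xq).2) xq.
  have H4 := power_sum_near0 bR xq.
  have a0 : weighted_coef 0 = 0 by rewrite /weighted_coef mulr0 !mul0r.
  have e0 : euler_coef 0 = 1.
    by rewrite /euler_coef qpoch0 bin0n !expr0 mulr1 divr1.
  have s0 : square_coef x 0 = 0.
    by rewrite /square_coef expr0 subrr !mul0r invr0 mulr0.
  have l0 : lambert_coef 0 = 0 by rewrite /lambert_coef expr0 subrr mul0r invr0.
  rewrite a0 subr0 in H1; rewrite e0 in H2; rewrite s0 subr0 in H3.
  rewrite l0 subr0 in H4.
  have H5 := norm_le_of_near0 H2 x1 D0; rewrite normr1 in H5.
  move: H1 H3 H4 H5; rewrite /f /weighted_sum /euler_sum /square_sum /lambert_sum.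
  move: (power_sum _ x) (power_sum _ x) (power_sum _ x) (power_sum _ x) => a s l ee.
  move: (B / _) D0 => D D0 H1 H3 H4 H5; rewrite subr0.
  apply: le_trans (ler_normD _ _) _; rewrite mulrDl lerD // normrM -mulrA ler_pM //.
  by rewrite mulrDl; apply: le_trans (ler_normB _ _) _; rewrite lerD.
by have := shift_eq_qpoch_inf fM f0 eq; rewrite mulr0 /f euler_sumE.
Qed.

(** Euler's expansion yields one bound on the whole disc, where [norm_qpoch_bounded] gives one for
    each e. *)
Lemma qpoch_inf_bounded : exists2 D : K, 0 <= D &
  forall e, `|e| <= `|q| -> `|qpoch_inf e q| <= D.
Proof.
have [B [bE _ _ _ _]] := coef_bounds.
have B0 : 0 <= B by apply: le_trans (bE 0%N).
have D0 : 0 <= B / (1 - `|q|) by rewrite divr_ge0 // subr_ge0 ltW.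
exists (1 + B / (1 - `|q|)); first by rewrite addr_ge0.
move=> e eq; have e0 : euler_coef 0 = 1.
  by rewrite /euler_coef qpoch0 bin0n !expr0 mulr1 divr1.
have := power_sum_near0 bE eq; rewrite e0 => H.
have := norm_le_of_near0 H (le_trans eq (ltW q1)) D0.
by rewrite normr1 -[power_sum _ _]/(euler_sum e) euler_sumE.
Qed.

End PowerSeries.

Lemma has_sum0 (K : numFieldType) (a : nat -> K) : (forall n, a n = 0) -> has_sum a 0.
Proof.
move=> a0; have H : (fun=> 0 : K) @ \oo --> (0 : K) by exact: cvg_cst.
by apply: (cvg_fun_ext H) => N; rewrite big1_seq.
Qed.

Lemma has_sum_from1 (K : numFieldType) (a : nat -> K) s : a 0%N = 0 -> has_sum a s ->
  (fun N => \sum_(1 <= n < N) a n) @ \oo --> s.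
Proof.
move=> a0 Hs; apply: (cvg_fun_ext Hs) => -[|N]; first by rewrite !big_geq.
by rewrite big_ltn // a0 add0r.
Qed.

Lemma has_sum_geometric (R : realType) (x : Cplx R) : `|x| < 1 ->
  has_sum (fun n => x ^+ n) (1 - x)^-1.
Proof.
move=> x1; have [s Hs] : exists s, has_sum (fun n => x ^+ n) s.
  apply: (geometric_has_sum (C := 1) (normr_ge0 x) x1) => n.
  by rewrite mul1r normrX.
suff -> : (1 - x)^-1 = s by [].
have : s - x * s = 1 + x * 0.
  have := has_sum_unique (has_sumS Hs).
  move=> /(_ (x * s)) E; rewrite mulr0 addr0 -E ?expr0; first by ring.
  by apply: (has_sum_ext (has_sumZ x Hs)) => n; rewrite exprS.
rewrite mulr0 addr0 => E; apply: (mulfI (one_sub_neq0 x1)).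
by rewrite mulfV ?one_sub_neq0 // mulrBl mul1r E.
Qed.

(** * The two sides of the identity *)

Section Sides.
Variables (R : realType) (q c : Cplx R).
Hypotheses (q1 : `|q| < 1) (c1 : `|c| < 1).
Notation K := (Cplx R).
Implicit Types (k n : nat).

Lemma base_expr_le n : `|q ^+ n.+1| <= `|q|.
Proof. by rewrite exprS normM_expr_le. Qed.

Lemma normc_expr_lt1 n : `|c * q ^+ n| < 1.
Proof. by apply: le_lt_trans c1; exact: normM_expr_le. Qed.

Lemma c_base_expr_le n : `|c * q ^+ n.+1| <= `|q|.
Proof.
rewrite normrM; apply: le_trans (base_expr_le n).
by rewrite ler_piMl // ltW.
Qed.

Lemma fine_has_sum n :
  has_sum (fine_term 0 (q ^+ n) (c * q ^+ n) q) (fineF 0 (q ^+ n) (c * q ^+ n) q).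
Proof.
have [M M1 HM] := inv_qpoch_bounded q1 (normr_ge0 q) q1.
have [s Hs] : exists s, has_sum (fine_term 0 (q ^+ n) (c * q ^+ n) q) s.
  apply: (geometric_has_sum (C := M) (normr_ge0 c) c1) => m.
  rewrite /fine_term mul0r qpoch0l mul1r normrM normrX ler_pM ?exprn_ge0 //.
    by rewrite HM // -exprSr base_expr_le.
  by rewrite lerXn2r ?nnegrE // normM_expr_le.
suff -> : fineF 0 (q ^+ n) (c * q ^+ n) q = s by [].
exact: cvg_numField_lim Hs.
Qed.

(** * The left side as double series in n and k *)

Definition u_term n : K :=
  (-1) ^+ n.-1 * n%:R * q ^+ (n * n.+1)./2 / ((1 - c * q ^+ n) * qpoch q q n).
Definition v_term n : K :=
  q ^+ (n * n.+1) * qpoch_inf (q ^+ n.+1) q / ((1 - q ^+ n) * qpoch q q n)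
    * fineF 0 (q ^+ n) (c * q ^+ n) q.
Definition w_term n : K :=
  qpoch (c * q) q n / qpoch q q n * (q ^+ n / (1 - q ^+ n)).

(** Expand 1/(1 - c q^n) geometrically; n(n+1)/2 = C(n,2) + n then produces (q^(k+1))^n. *)
Lemma u_term_sum : exists2 s, has_sum u_term s &
  has_sum (fun k => weighted_sum q (q ^+ k.+1) * c ^+ k) s.
Proof.
have [B [_ bA _ _ _]] := coef_bounds q1.
apply: (has_sum_swap (a := fun n k => weighted_coef q n * (q ^+ k.+1) ^+ n * c ^+ k)
  (C := B) (normr_ge0 q) q1 (normr_ge0 c) c1) => [n k|n|k].
- rewrite normrM normrX ler_wpM2r ?exprn_ge0 //.
  by apply: normM_expr_le_base => //; exact: base_expr_le.
- have -> : u_term n = weighted_coef q n * q ^+ n * (1 - c * q ^+ n)^-1.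
    rewrite /u_term /weighted_coef invfM.
    have -> : ((n * n.+1)./2 = 'C(n, 2) + n)%N.
      by have := binS n 1; rewrite bin1 bin2 /= mulnC => ->.
    by rewrite exprD; ring.
  apply: (has_sum_ext (has_sumZ _ (has_sum_geometric (normc_expr_lt1 n)))) => k.
  by rewrite -exprM mulSn exprD exprMn -exprM mulnC; ring.
- have H := has_sumZ (c ^+ k) (has_power_sum q1 bA (base_expr_le k)).
  by rewrite mulrC; apply: (has_sum_ext H) => n; rewrite mulrC.
Qed.

(** In Fine's series, (q^(n+1);q)_inf / (q^(n+1);q)_k = (q^(n+k+1);q)_inf = (q^(k+1);q)_inf /
    (q^(k+1);q)_n. *)
Lemma v_term_sum : exists2 s, has_sum v_term s &
  has_sum (fun k => qpoch_inf (q ^+ k.+1) q * square_sum q (q ^+ k.+1) * c ^+ k) s.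
Proof.
have [B [_ _ _ _ bC]] := coef_bounds q1; have [D D0 HD] := qpoch_inf_bounded q1.
apply: (has_sum_swap (a := fun n k => square_coef q (q ^+ k.+1) n * (q ^+ k.+1) ^+ n
    * (qpoch_inf (q ^+ k.+1) q * c ^+ k))
  (C := B * D) (normr_ge0 q) q1 (normr_ge0 c) c1) => [n k|n|k].
- rewrite mulrA normrM normrX ler_wpM2r ?exprn_ge0 // normrM [leRHS]mulrAC.
  apply: ler_pM; rewrite ?HD ?base_expr_le //.
  apply: normM_expr_le_base (base_expr_le k) => m.
  exact: (bC _ m (base_expr_le k)).2.
- have H := has_sumZ (q ^+ (n * n.+1) * qpoch_inf (q ^+ n.+1) q
    / ((1 - q ^+ n) * qpoch q q n)) (fine_has_sum (n := n)).
  apply: (has_sum_ext H) => k; rewrite /square_coef /fine_term.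
  case: n {H} => [|n]; first by rewrite expr0 subrr !mul0r invr0 !mulr0 !mul0r.
  have E1 := qpoch_infE (q ^+ n.+2) k q1; have E2 := qpoch_infE (q ^+ k.+1) n.+1 q1.
  rewrite -exprD in E1; rewrite -exprD in E2.
  rewrite (_ : n.+2 + k = k.+1 + n.+1)%N in E1; last by lia.
  rewrite E1 E2 mul0r qpoch0l -exprSr.
  have n0 := qpoch_small_neq0 q1 n.+1 (lexx `|q|).
  have n1 := one_sub_expr_neq0 q1 n.
  have n2 := qpoch_small_neq0 q1 n.+1 (base_expr_le k).
  have n3 := qpoch_small_neq0 q1 k (base_expr_le n.+1).
  have -> : q ^+ (n.+1 * n.+2) = q ^+ (n.+1 * n.+1) * q ^+ n.+1.
    by rewrite -exprD; congr (_ ^+ _); lia.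
  have -> : (q ^+ k.+1) ^+ n.+1 = q ^+ n.+1 * (q ^+ n.+1) ^+ k.
    by rewrite -!exprM -exprD; congr (_ ^+ _); lia.
  rewrite exprMn; move: (q ^+ n.+1) n1 => z n1.
  by field; rewrite n0 n1 n2 n3.
- have bS m := (bC _ m (base_expr_le k)).2.
  have H := has_sumZ (qpoch_inf (q ^+ k.+1) q * c ^+ k)
    (has_power_sum q1 bS (base_expr_le k)).
  by rewrite mulrAC; apply: (has_sum_ext H) => n; rewrite mulrC.
Qed.

(** For n >= 1 the last factor is 1/(c q^n;q)_inf by [geom_sumE]. At n = 0, where c may lie outside
    |e| <= |q|, [lambert_coef] is 0. *)
Definition lhs_term n : K :=
  qpoch_inf q q * (lambert_coef q n * q ^+ n) * geom_sum q (c * q ^+ n).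

(** As (q^(k+1);q)_inf = (q;q)_inf / (q;q)_k, the sum over k is Euler's series at c q^n. *)
Lemma lhs_term_sum : exists2 s, has_sum lhs_term s &
  has_sum (fun k => qpoch_inf (q ^+ k.+1) q * lambert_sum q (q ^+ k.+1) * c ^+ k) s.
Proof.
have [B [_ _ bG bR _]] := coef_bounds q1; have [D D0 HD] := qpoch_inf_bounded q1.
apply: (has_sum_swap (a := fun n k => lambert_coef q n * (q ^+ k.+1) ^+ n
    * (qpoch_inf (q ^+ k.+1) q * c ^+ k))
  (C := B * D) (normr_ge0 q) q1 (normr_ge0 c) c1) => [n k|n|k].
- rewrite mulrA normrM normrX ler_wpM2r ?exprn_ge0 // normrM [leRHS]mulrAC.
  apply: ler_pM; rewrite ?HD ?base_expr_le //.
  exact: normM_expr_le_base (base_expr_le k).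
- case: n => [|n].
    have z0 : lambert_coef q 0 = 0 by rewrite /lambert_coef expr0 subrr mul0r invr0.
    rewrite /lhs_term z0 mul0r mulr0 mul0r.
    by apply: has_sum0 => k; rewrite !mul0r.
  have H := has_power_sum q1 bG (c_base_expr_le n).
  apply: (has_sum_ext (has_sumZ (qpoch_inf q q * (lambert_coef q n.+1 * q ^+ n.+1)) H)).
  move=> k; have E := qpoch_infE q k q1; rewrite -exprS in E.
  have n0 := qpoch_small_neq0 q1 k (lexx `|q|).
  have -> : (q ^+ k.+1) ^+ n.+1 = q ^+ n.+1 * (q ^+ n.+1) ^+ k.
    by rewrite -!exprM -exprD; congr (_ ^+ _); lia.
  rewrite E /geom_coef exprMn; move: (lambert_coef q _) (q ^+ n.+1) => l z.
  by field.
- have H := has_sumZ (qpoch_inf (q ^+ k.+1) q * c ^+ k)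
    (has_power_sum q1 bR (base_expr_le k)).
  by rewrite mulrAC; apply: (has_sum_ext H) => n; rewrite mulrC.
Qed.

Lemma lhs_has_sum : exists s t,
  [/\ has_sum u_term s, has_sum v_term t & has_sum lhs_term (s + t)].
Proof.
have [s us us'] := u_term_sum; have [t vt vt'] := v_term_sum.
have [r wr wr'] := lhs_term_sum; exists s, t.
suff -> : s + t = r by split; [exact: us|exact: vt|exact: wr].
apply: (has_sum_unique _ wr'); apply: (has_sum_ext (has_sumD us' vt')) => k.
have := weighted_square_lambert q1 (base_expr_le k).
move: (weighted_sum _ _) (qpoch_inf _ _) (square_sum _ _) (lambert_sum _ _).
move=> a Q sq l /eqP; rewrite addr_eq0 => /eqP ->.
by ring.
Qed.

(** * Comparison with the right side *)

Lemma w_has_sum : exists s, has_sum w_term s.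
Proof.
have [B [_ _ _ bR _]] := coef_bounds q1; have [M HM] := norm_qpoch_bounded (c * q) q1.
apply: (geometric_has_sum (C := M * B) (normr_ge0 q) q1) => n.
have -> : w_term n = qpoch (c * q) q n * lambert_coef q n * q ^+ n.
  by rewrite /w_term /lambert_coef invfM; ring.
by rewrite 2!normrM normrX ler_wpM2r ?exprn_ge0 // ler_pM.
Qed.

(** The partial sum through n = N telescopes to (cq;q)_N / (q;q)_N. *)
Lemma qpoch_ratio_has_sum :
  has_sum (fun n => q ^+ n * (qpoch c q n / qpoch q q n))
    (qpoch_inf (c * q) q / qpoch_inf q q).
Proof.
have E N : \sum_(0 <= n < N.+1) q ^+ n * (qpoch c q n / qpoch q q n)
    = qpoch (c * q) q N / qpoch q q N.
  elim: N => [|N IH]; first by rewrite big_nat1 !qpoch0 expr0 mul1r.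
  rewrite big_nat_recr //= IH (qpochSl c) !qpochS exprS.
  have n0 := qpoch_small_neq0 q1 N (lexx `|q|).
  have n1 := qpochS_neq0 q1 N (lexx `|q|).
  by field; rewrite n0 n1.
rewrite /has_sum -(cvg_shiftS _ _).
apply: (cvg_fun_ext (u := fun N => qpoch (c * q) q N * (qpoch q q N)^-1)).
  apply: cvgM; first exact: cvg_qpoch.
  by apply: cvgV; [exact: qpoch_inf_neq0|exact: cvg_qpoch].
by move=> N; exact: esym (E N).
Qed.

(** Since 1/(c q^n;q)_inf = (c;q)_n / (c;q)_inf and (cq;q)_n - (c;q)_n = (c;q)_n c (1-q^n)/(1-c),
    the termwise difference loses 1/(1-q^n) and becomes a multiple of the series of
    [qpoch_ratio_has_sum], without its term at n = 0. *)
Lemma rhs_eq s t : has_sum lhs_term s -> has_sum w_term t ->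
  s = - c / (1 - c) ^+ 2 + qpoch_inf q q / qpoch_inf c q * (c / (1 - c) + t).
Proof.
move=> Hs Ht; have c0 := one_sub_neq0 c1.
have Q0 := qpoch_inf_neq0 q1 q1; have C0 := qpoch_inf_neq0 q1 c1.
have CE := qpoch_infE c 1 q1; rewrite qpoch1 expr1 in CE.
have C0' : qpoch_inf (c * q) q != 0 by move: C0; rewrite CE mulf_eq0 negb_or => /andP[].
have l0 : lhs_term 0 = 0.
  by rewrite /lhs_term /lambert_coef expr0 subrr mul0r invr0 mul0r mulr0 mul0r.
have w0 : w_term 0 = 0 by rewrite /w_term expr0 subrr invr0 !mulr0.
have := has_sumS (has_sumB (has_sumZ (qpoch_inf q q / qpoch_inf c q) Ht) Hs).
rewrite l0 w0 mulr0 !subr0 => H1.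
have := has_sumS qpoch_ratio_has_sum; rewrite expr0 !qpoch0 mul1r divr1.
move=> /(has_sumZ (c / (1 - c) * (qpoch_inf q q / qpoch_inf c q))) H2.
have H3 : qpoch_inf q q / qpoch_inf c q * t - s =
    c / (1 - c) * (qpoch_inf q q / qpoch_inf c q)
      * (qpoch_inf (c * q) q / qpoch_inf q q - 1).
  apply: (has_sum_unique H1); apply: (has_sum_ext H2) => n.
  have CnE := qpoch_infE c n.+1 q1; have GE := geom_sumE q1 (c_base_expr_le n).
  have n0 := qpoch_small_neq0 q1 n.+1 (lexx `|q|).
  have n1 := one_sub_expr_neq0 q1 n.
  have n2 : qpoch c q n.+1 != 0 by exact: qpoch_neq0.
  have n3 := qpoch_inf_neq0 q1 (normc_expr_lt1 n.+1).
  have G : geom_sum q (c * q ^+ n.+1) = (qpoch_inf (c * q ^+ n.+1) q)^-1.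
    by apply: (mulfI n3); rewrite GE mulfV.
  have P : qpoch (c * q) q n.+1 = qpoch c q n.+1 * (1 - c * q ^+ n.+1) / (1 - c).
    by rewrite -qpochS (qpochSl c q n.+1); field.
  rewrite /lhs_term /w_term G P CnE /lambert_coef.
  move: (qpoch_inf (c * q ^+ n.+1) q) n3 => y y0.
  move: (qpoch_inf q q) (qpoch c q n.+1) n2 (qpoch q q n.+1) n0 (q ^+ n.+1) n1
    => Qi Pn Pn0 Qn Qn0 z z0.
  by field; rewrite y0 Pn0 Qn0 z0 c0.
(* By (c;q)_inf = (1-c) (cq;q)_inf the product with the ratio is c/(1-c)^2; the -1 supplies the
   c/(1-c) in the bracket. *)
move: H3; rewrite CE; move: (qpoch_inf q q) Q0 (qpoch_inf _ _) C0' => Qi Qi0 Ci Ci0.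
move=> H3; rewrite -[LHS](subKr (Qi / ((1 - c) * Ci) * t)) H3.
by field; rewrite Qi0 Ci0 c0.
Qed.

End Sides.

(* [lim] is total, so the convergence of every infinite product and series
   occurring in the identity is asserted alongside it. *)
Theorem theorem2p8 (R : realType) (q c : Cplx R)
    (hq : `|q| < 1) (hc : `|c| < 1) :
  let u (n : nat) : Cplx R :=
    (-1) ^+ n.-1 * n%:R * q ^+ (n * n.+1)./2
      / ((1 - c * q ^+ n) * qpoch q q n) in
  let v (n : nat) : Cplx R :=
    q ^+ (n * n.+1) * qpoch_inf (q ^+ n.+1) q
      / ((1 - q ^+ n) * qpoch q q n)
      * fineF 0 (q ^+ n) (c * q ^+ n) q in
  let w (n : nat) : Cplx R :=
    qpoch (c * q) q n / qpoch q q n * (q ^+ n / (1 - q ^+ n)) in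
  [/\ (forall A : Cplx R, cvgn (qpoch A q)),
      (forall n : nat, (0 < n)%N ->
         cvgn (fun N => \sum_(0 <= m < N)
                 fine_term 0 (q ^+ n) (c * q ^+ n) q m)),
      [/\ cvgn (fun N => \sum_(1 <= n < N) u n),
          cvgn (fun N => \sum_(1 <= n < N) v n)
        & cvgn (fun N => \sum_(1 <= n < N) w n)]
    & \big[+%R/0]_(1 <= n <oo) u n + \big[+%R/0]_(1 <= n <oo) v n
      = - c / (1 - c) ^+ 2
        + qpoch_inf q q / qpoch_inf c q
          * (c / (1 - c) + \big[+%R/0]_(1 <= n <oo) w n)].
Proof.
move=> u v w; have [s [t [us vt st]]] := lhs_has_sum hq hc.
have [r wr] := w_has_sum c hq.
(* The terms at n = 0 vanish, for u by the factor n and for v and w by 1/(1 - q^0) = 0, so the sums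
   may start at 1. *)
have u0 : u_term q c 0 = 0 by rewrite /u_term mulr0 !mul0r.
have v0 : v_term q c 0 = 0.
  have z0 : 1 - q ^+ 0 = 0 by rewrite expr0 subrr.
  by rewrite /v_term z0 mul0r invr0 mulr0 mul0r.
have w0 : w_term q c 0 = 0 by rewrite /w_term expr0 subrr invr0 !mulr0.
have U := has_sum_from1 u0 us; have V := has_sum_from1 v0 vt.
have W := has_sum_from1 w0 wr.
split=> [A|n _||].
- exact: cvg_numField_cvgn (cvg_qpoch hq).
- have Hn := fine_has_sum hq hc (n := n); rewrite /has_sum in Hn.
  exact: cvg_numField_cvgn Hn.
- split; [exact: cvg_numField_cvgn U|exact: cvg_numField_cvgn V|].
  exact: cvg_numField_cvgn W.
rewrite (cvg_numField_lim U) (cvg_numField_lim V) (cvg_numField_lim W).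
exact (rhs_eq hq hc st wr).
Qed.
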